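(* For every dimension $d\ge 2$ and every acceleration parameter $z\in[0,1)$, the qudit Unruh channel is a Hadamard channel, i.e. its complementary channel is entanglement-breaking.
   Context: Let $N(m)=\{\vec n\in\mathbb{Z}_{\ge0}^d:\sum_i n_i=m\}$ and $|(n_1,\dots,n_d)\rangle$ the $d$-mode Fock state. Write $z=\tanh^2 r$. The qudit Unruh channel $\mathcal{N}$ takes input states on the $d$-dimensional single-excitation space spanned by $|\vec e_i\rangle=|(0,\dots,0,1_i,0,\dots,0)\rangle$ and is given by $\mathcal{N}(\rho)=\mathrm{Tr}_E(V\rho V^\dagger)$ for the isometry $$V|\vec e_i\rangle=\frac{1}{\cosh^{d+1}r}\sum_{k=1}^\infty\tanh^{k-1}r\sum_{\vec n\in N(k-1)}\sqrt{1+n_i}\;|(n_1,\dots,1+n_i,\dots,n_d)\rangle_B\otimes|(n_1,\dots,n_d)\rangle_E$$ (this is the restriction of the two-mode-squeezing unitary $\bigotimes_i\exp[r(a_i^\dagger e_i^\dagger-a_ie_i)]$ with environment in vacuum). Its complementary channel is $\mathcal{N}^c(\rho)=\mathrm{Tr}_B(V\rho V^\dagger)$. A channel $\mathcal{M}$ is entanglement-breaking if $(\mathrm{id}\otimes\mathcal{M})(\Phi)$ is separable for the maximally entangled state $\Phi$ (equivalently, for all inputs); a channel is Hadamard if its complementary channel is entanglement-breaking. *)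

(* Defs.v *)
(* MathComp + MathComp-Analysis (R : realType), complex numbers R[i]
   from mathcomp-real-closed. *)
From HB Require Import structures.
From mathcomp Require Import all_boot all_order all_algebra.
From mathcomp Require Import complex.
From mathcomp Require Import boolp classical_sets reals.
From mathcomp.analysis Require Import sequences.
Set Implicit Arguments. Unset Strict Implicit. Unset Printing Implicit Defensive.
Import Order.TTheory GRing.Theory Num.Theory.
Local Open Scope ring_scope.
Local Open Scope complex_scope.

Section Defs.
Variable R : realType.
Notation C := R[i].

(* hyperbolic functions *)
Definition cosh (r : R) : R := (expR r + expR (- r)) / 2.
Definition sinh (r : R) : R := (expR r - expR (- r)) / 2.
Definition tanh (r : R) : R := sinh r / cosh r.

(* unconditional (net) convergence of a family indexed by an eqType *)
Definition has_sum (T : eqType) (f : T -> C) (s : C) : Prop :=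
  forall eps : R, 0 < eps -> exists F0 : seq T, forall F : seq T,
    uniq F -> {subset F0 <= F} -> `| \sum_(x <- F) f x - s | < eps%:C.

(* the sum of a summable family (0 if not summable) *)
Definition csum (T : eqType) (f : T -> C) : C :=
  xget 0 [set s | has_sum f s].

(* operators on l^2(T), T countable, given by their matrix kernels *)
Definition kernel (T : Type) := T -> T -> C.

(* partial trace over the first factor of l^2(B) (x) l^2(E) *)
Definition ptrace_1 (B E : eqType) (X : kernel (B * E)) : kernel E :=
  fun e e' => csum (fun b : B => X (b, e) (b, e')).

(* V rho V^dagger for V : C^d -> l^2(T), given by V|i> = V i *)
Definition conj_by (d : nat) (T : Type) (V : 'I_d -> T -> C)
    (rho : 'M[C]_d) : kernel T :=
  fun p q => \sum_(i < d) \sum_(j < d) V i p * rho i j * (V j q)^*.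

(* complementary channel of the isometry V : C^d -> l^2(B) (x) l^2(E) *)
Definition complementary (d : nat) (B E : eqType)
    (V : 'I_d -> B * E -> C) (rho : 'M[C]_d) : kernel E :=
  ptrace_1 (conj_by V rho).

(* (id (x) M)(Phi) for Phi the maximally entangled state on C^d (x) C^d:
   Phi = 1/d sum_{i,j} |i><j| (x) |i><j| *)
Definition choi (d : nat) (T : Type) (M : 'M[C]_d -> kernel T)
    : kernel ('I_d * T) :=
  fun p q => (d%:R)^-1 * M (delta_mx p.1 q.1) p.2 q.2.

(* separable state on C^d (x) l^2(T): a (countable) convex combination
   of product pure states, convergent entrywise *)
Definition separable (d : nat) (T : eqType) (rho : kernel ('I_d * T)) : Prop :=
  exists (p : nat -> R) (a : nat -> 'I_d -> C) (b : nat -> T -> C),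
    [/\ forall k, 0 <= p k,
        has_sum (fun k => (p k)%:C) 1,
        forall k, \sum_(i < d) `|a k i| ^+ 2 = 1,
        forall k, has_sum (fun e => `|b k e| ^+ 2) 1 &
        forall x y, has_sum
          (fun k => (p k)%:C * (a k x.1 * (a k y.1)^*) * (b k x.2 * (b k y.2)^*))
          (rho x y)].

Definition entanglement_breaking (d : nat) (T : eqType)
    (M : 'M[C]_d -> kernel T) : Prop :=
  separable (choi M).

(* a channel given by the isometry V is Hadamard if its complementary
   channel is entanglement-breaking *)
Definition hadamard (d : nat) (B E : eqType) (V : 'I_d -> B * E -> C) : Prop :=
  entanglement_breaking (complementary V).

(* d-mode Fock basis labels *)
Definition fock (d : nat) := {ffun 'I_d -> nat}.
Definition tot (d : nat) (n : fock d) : nat := \sum_(j < d) n j.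
Definition raise (d : nat) (n : fock d) (i : 'I_d) : fock d :=
  [ffun j => n j + (j == i)].

(* the qudit Unruh isometry: amplitude of |b>_B (x) |e>_E in V|e_i>;
   the term with n = e, k - 1 = |e| of the defining sum *)
Definition unruhV (d : nat) (r : R) (i : 'I_d) (be : fock d * fock d) : C :=
  let: (b, e) := be in
  if b == raise e i then
    ((tanh r ^+ tot e / cosh r ^+ d.+1 * Num.sqrt (1 + (e i)%:R)) : R)%:C
  else 0.

End Defs.

Arguments unruhV {R} d r i be.

(* Main.v *)
(** Write [z = tanh^2 r].  The part of the Choi state of the complementary channel
    with [|e| = k] is a multiple of the orthogonal projector onto [Sym^{k+1} C^d]
    inside [C^d (x) Sym^k C^d].  That projector is proportional to the average of
    the projectors onto [phi (x) phi^{(x) k}] over a Gaussian vector [phi], hence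
    separable.  To obtain a countable mixture, the coordinates of [phi] are made
    discrete: only the moments [E (phi^a conj(phi)^b) = (a == b) a!] with
    [a, b <= k+1] matter, and they are matched by [sqrt x * omega], where [omega]
    ranges over roots of unity and [x] over the nodes of a Gauss-Laguerre
    quadrature.  Both discrete laws are read off the spectral theorem, applied to
    a cyclic shift and to the Jacobi matrix of the Laguerre polynomials.  The
    total mass is the negative binomial series
    [sum_k C(k+d, d) z^k = (1 - z)^{-(d+1)}], where [1 - z = 1 / cosh^2 r]. *)
Require Import Defs.
From HB Require Import structures.
From mathcomp Require Import all_boot all_order all_algebra.
From mathcomp Require Import fingroup perm zify ring.
From mathcomp Require Import complex.
From mathcomp Require Import boolp classical_sets reals topology normedtype.
From mathcomp.analysis Require Import sequences exp.
Import Order.TTheory GRing.Theory Num.Theory numFieldNormedType.Exports.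
Local Open Scope ring_scope.
Set Implicit Arguments. Unset Strict Implicit. Unset Printing Implicit Defensive.

(** * Discrete laws with Gaussian moments, from the spectral theorem *)

Local Open Scope sesquilinear_scope.

(** The numbers [|P l i| ^+ 2] form the spectral measure of basis vector [i]; diagonal entries of
    words in [A] and its adjoint are its moments. *)
Lemma normal_diag_moments (C : numClosedFieldType) n (A : 'M[C]_n.+1) :
  A \is normalmx -> exists (P : 'M[C]_n.+1) (D : 'rV[C]_n.+1),
  P *m A *m P ^t* = diag_mx D /\
  forall i a b, (A ^+ a * (A ^t*) ^+ b) i i =
    \sum_l `|P l i| ^+ 2 * (D 0 l ^+ a * (D 0 l)^* ^+ b).
Proof.
move=> /orthomx_spectralP; set P := spectralmx A; set D := spectral_diag A.
have Pu : P \is unitarymx by exact: spectral_unitarymx.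
rewrite invmx_unitary // => AE.
have PP : P *m P ^t* = 1%:M by exact/unitarymxP.
have PP' : P ^t* *m P = 1%:M by exact: mulmx1C.
exists P, D; split.
  by rewrite AE !mulmxA PP mul1mx -mulmxA PP mulmx1.
pose cD : 'rV[C]_n.+1 := \row_l (D 0 l)^*.
have AsE : A ^t* = P ^t* *m diag_mx cD *m P.
  rewrite {1}AE !trmx_mul !map_mxM /= tr_diag_mx map_diag_mx trmxCK mulmxA.
  by congr (_ *m diag_mx _ *m _); apply/rowP => l; rewrite !mxE.
have powE (E : 'rV[C]_n.+1) a :
    (P ^t* *m diag_mx E *m P) ^+ a = P ^t* *m diag_mx (\row_l E 0 l ^+ a) *m P.
  elim: a => [|a IHa].
    rewrite expr0; suff -> : \row_l E 0 l ^+ 0 = const_mx 1 :> 'rV[C]_n.+1.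
      by rewrite diag_const_mx mulmx1 PP'.
    by apply/rowP => l; rewrite !mxE expr0.
  rewrite exprS IHa -mulmxE !mulmxA -(mulmxA _ P) PP mulmx1.
  rewrite -[X in X *m P]mulmxA mulmx_diag; congr (_ *m diag_mx _ *m _).
  by apply/rowP => l; rewrite !mxE exprS.
move=> i a b; rewrite {1}AE AsE !powE -mulmxE !mulmxA -(mulmxA _ P) PP mulmx1.
rewrite -[X in X *m P]mulmxA mulmx_diag -mulmxA mxE; apply: eq_bigr => l _.
by rewrite mul_diag_mx !mxE mulrCA normCK mulrC (mulrC (P l i)).
Qed.

Section GaussLaguerre.
Variables (C : numClosedFieldType) (n : nat).

(* [B *m B ^t*] is, up to signs, the truncated Jacobi matrix of the Laguerre
   polynomials; its powers send the first basis vector to the [v m], which are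
   the Laguerre coefficients of [x^m]. *)
Let B : 'M[C]_n.+1 := \matrix_(l, k)
  ((l == k)%:R * sqrtC (l.+1%:R) + (l == k.+1 :> nat)%:R * sqrtC l%:R).

Let v m : 'cV[C]_n.+1 := \col_l (m`! * 'C(m, l))%:R.

Let sqrtC_nat_real m : (sqrtC m%:R : C)^* = sqrtC m%:R.
Proof. by apply: geC0_conj; rewrite sqrtC_ge0 ler0n. Qed.

(** Column [k] of [B] carries [sqrt (k+1)] in rows [k] and [k+1], so this is Pascal's rule. *)
Let Bv m : (m <= n)%N ->
  B ^t* *m v m = \col_k (sqrtC k.+1%:R * (m`! * 'C(m.+1, k.+1))%:R).
Proof.
move=> mn; apply/colP => k; rewrite !mxE.
under eq_bigr => l _.
  rewrite !mxE rmorphD !rmorphM /= !rmorph_nat !sqrtC_nat_real mulrDl.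
  over.
rewrite big_split /= (bigD1 k) //= eqxx mul1r big1 ?addr0; last first.
  by move=> i /negbTE; rewrite -val_eqE => ->; rewrite !mul0r.
have [kn|kn] := ltnP k n.
  have k1 : (k.+1 < n.+1)%N by [].
  rewrite (bigD1 (Ordinal k1)) //= eqxx mul1r big1 ?addr0; last first.
    by move=> i /negbTE; rewrite -val_eqE /= => ->; rewrite !mul0r.
  by rewrite -mulrDr -mulrDr -natrD -natrM binS addnC.
(* In the last row the term ['C(m, k.+1)] of Pascal's rule falls outside the matrix; it is zero
   because [m <= n]. *)
rewrite big1 ?addr0 => [|i _]; last first.
  by rewrite ltn_eqF ?mul0r // (leq_trans (ltn_ord i)).
rewrite -natrM; congr (_ * (_ * _)%:R); rewrite binS (@bin_small m k.+1) ?add0n // ltnS (leq_trans mn kn) //.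
Qed.

(** Coordinate [l] is [m! ((l+1) C(m+1, l+1) + l C(m+1, l))], and
    [(l+1) C(m+1, l+1) = (m+1-l) C(m+1, l)]. *)
Let BBv m : (m <= n)%N -> B *m B ^t* *m v m = v m.+1.
Proof.
move=> mn; rewrite -mulmxA Bv //; apply/colP => l; rewrite !mxE.
under eq_bigr => k _ do rewrite !mxE mulrDl.
rewrite big_split /= (bigD1 l) //= eqxx mul1r big1 ?addr0; last first.
  by move=> i; rewrite eq_sym => /negbTE ->; rewrite !mul0r.
rewrite mulrA -expr2 sqrtCK.
have -> : \sum_(i < n.+1) (l == i.+1 :> nat)%:R * sqrtC l%:R *
     (sqrtC i.+1%:R * (m`! * 'C(m.+1, i.+1))%:R) = l%:R * (m`! * 'C(m.+1, l))%:R :> C.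
  case: l => [[|l] ll] /=.
    by rewrite big1 => [|i _]; rewrite !mul0r.
  have ln : (l < n.+1)%N by exact: ltnW.
  rewrite (bigD1 (Ordinal ln)) //= eqxx mul1r mulrA -expr2 sqrtCK big1 ?addr0 //.
  by move=> i; rewrite eqSS -val_eqE eq_sym /= => /negbTE ->; rewrite !mul0r.
rewrite -!natrM -natrD; congr _%:R.
have := mul_bin_left m.+1 l; have [|lm] := leqP l m.+1.
  rewrite factS; set c := 'C(_, _); set c' := 'C(_, _); set f := m`!.
  by move=> lm E; rewrite mulnCA E; nia.
by rewrite (bin_small lm) (@bin_small m.+1 l.+1) ?muln0 ?addn0 ?muln0 // ltnS ltnW.
Qed.

(** The nodes are the eigenvalues of [J = B *m B ^t*], the weights its spectral measure at the first
    basis vector [v 0]. The [m]-th moment is the first coordinate of [J ^+ m *m v 0 = v m], which is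
    [m!]. *)
Lemma gauss_laguerre : exists w x : 'I_n.+1 -> C,
  [/\ forall l, 0 <= w l, forall l, 0 <= x l &
      forall m, (m <= n)%N -> \sum_l w l * x l ^+ m = m`!%:R].
Proof.
pose J := B *m B ^t*.
have Jsym : J ^t* = J by rewrite trmx_mul map_mxM /= trmxCK.
have [|P [D [PD mom]]] := @normal_diag_moments _ _ J.
  by apply/normalmxP; rewrite Jsym.
exists (fun l => `|P l 0| ^+ 2), (fun l => D 0 l); split => [l|l|m mn].
- by rewrite exprn_ge0.
(* The eigenvalue is the squared norm of row [l] of [P *m B]. *)
- have : diag_mx D l l = D 0 l by rewrite mxE eqxx mulr1n.
  rewrite -PD /J => <-; rewrite !mulmxA -(mulmxA (P *m B)).
  have -> : B ^t* *m P ^t* = (P *m B) ^t* by rewrite trmx_mul map_mxM.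
  by rewrite mxE sumr_ge0 // => k _; rewrite [X in _ * X]mxE [X in _ * X^*]mxE mul_conjC_ge0.
- have := mom 0 m 0%N; rewrite expr0 mulr1.
  under [RHS]eq_bigr => l _ do rewrite expr0 mulr1.
  move=> <-.
  suff Jv : forall m, (m <= n)%N -> J ^+ m *m v 0 = v m.
    have := Jv _ mn => /matrixP /(_ 0 0); rewrite !mxE bin0 muln1 => <-.
    rewrite (bigD1 0) //= mxE bin0 mulr1 big1 ?addr0 // => i i0.
    by rewrite mxE bin_small ?mulr0 // lt0n.
  elim=> [_|a IHa an]; first by rewrite expr0 mul1mx.
  by rewrite exprS -mulmxE -mulmxA IHa ?(ltnW an) // BBv // ltnW.
Qed.

(** For the cyclic shift [S] of [n.+1] points, the moment is the [(0, 0)] entry of [S^a S^(-b)]: it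
    is 1 when [a] and [b] shifts take 0 to the same point, that is [a = b] in this range, and 0
    otherwise. *)
Lemma phase_quadrature : exists w x : 'I_n.+1 -> C,
  (forall l, 0 <= w l) /\
  forall a b, (a <= n)%N -> (b <= n)%N ->
    \sum_l w l * (x l ^+ a * (x l)^* ^+ b) = (a == b)%:R.
Proof.
pose s : {perm 'I_n.+1} := perm (@addrI _ (Zp1 : 'I_n.+1)).
pose S : 'M[C]_n.+1 := perm_mx s.
have Ss : S ^t* = perm_mx (s^-1)%g.
  by rewrite /S tr_perm_mx; apply/matrixP => i j; rewrite !mxE rmorph_nat.
have [|P [D [_ mom]]] := @normal_diag_moments _ _ S.
  by apply/normalmxP; rewrite Ss -!perm_mxM mulgV mulVg.
exists (fun l => `|P l 0| ^+ 2), (fun l => D 0 l); split => [l|a b an bn].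
  by rewrite exprn_ge0.
rewrite -mom Ss.
have powS (t : {perm 'I_n.+1}) m : (perm_mx t : 'M[C]_n.+1) ^+ m = perm_mx (t ^+ m)%g.
  elim: m => [|m IHm]; first by rewrite expr0 expg0 perm_mx1.
  by rewrite exprS IHm -mulmxE -perm_mxM expgS.
have pow0 m : (m <= n)%N -> val ((s ^+ m)%g 0) = m.
  elim: m => [|m IHm] mn; first by rewrite expg0 perm1.
  rewrite expgSr permM permE /= IHm ?(ltnW mn) // modnDml add1n modn_small //.
by rewrite !powS -mulmxE -perm_mxM !mxE permM expVgn -(inj_eq (@perm_inj _ (s ^+ b)%g))
  permKV -val_eqE !pow0.
Qed.

End GaussLaguerre.

(** Polar coordinates: the phase kills the moments with [a != b], and the squared modulus has the
    moments [a!] of the exponential law. *)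
Lemma gaussian_quadrature (C : numClosedFieldType) n :
  exists u phi : 'I_n.+1 * 'I_n.+1 -> C,
  (forall q, 0 <= u q) /\
  forall a b, (a <= n)%N -> (b <= n)%N ->
    \sum_q u q * (phi q ^+ a * (phi q)^* ^+ b) = (a == b)%:R * a`!%:R.
Proof.
have [w [x [w0 x0 wx]]] := gauss_laguerre C n.
have [w' [x' [w'0 w'x]]] := phase_quadrature C n.
exists (fun q => w q.1 * w' q.2), (fun q => sqrtC (x q.1) * x' q.2).
split=> [q|a b an bn]; first by rewrite mulr_ge0.
have cx l : (sqrtC (x l))^* = sqrtC (x l) by rewrite geC0_conj ?sqrtC_ge0.
rewrite -(pair_bigA _ (fun l l' => w l * w' l' *
  ((sqrtC (x l) * x' l') ^+ a * (sqrtC (x l) * x' l')^* ^+ b))) /=.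
under eq_bigr => l _ do under eq_bigr => l' _ do
  rewrite rmorphM /= cx !exprMn [X in _ * X]mulrACA -exprD mulrACA.
rewrite -big_distrlr /= w'x // mulrC; case: eqVneq => [<-|_]; last by rewrite !mul0r.
rewrite -wx // !mul1r; apply: eq_bigr => l _.
by rewrite addnn -mul2n exprM sqrtCK.
Qed.

(** * Unconditional sums and countable mixtures of product vectors *)

Lemma big_uniq_subset (V : nmodType) (T : eqType) (F G : seq T) (f : T -> V) :
  uniq F -> uniq G -> {subset F <= G} ->
  \sum_(x <- G) f x = \sum_(x <- F) f x + \sum_(x <- G | x \notin F) f x.
Proof.
move=> uF uG FG; rewrite (bigID (mem F)) /=; congr (_ + _).
rewrite -big_filter; apply: perm_big; apply: uniq_perm => //.
  exact: filter_uniq.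
by move=> x; rewrite mem_filter; apply: andb_idr => /FG.
Qed.

Section HasSum.
Variables (R : realType).
Notation C := R[i]%C.

Lemma has_sum_finite (T : eqType) (f : T -> C) (F : seq T) :
  uniq F -> (forall x, x \notin F -> f x = 0) -> has_sum f (\sum_(x <- F) f x).
Proof.
move=> uF f0 eps eps0; exists F => G uG FG.
rewrite (big_uniq_subset f uF uG FG) addrC addrA addNr add0r.
by rewrite big1 // normr0 ltcR.
Qed.

Lemma has_sum_unique (T : eqType) (f : T -> C) (s s' : C) :
  has_sum f s -> has_sum f s' -> s = s'.
Proof.
move=> fs fs'; apply/eqP; rewrite -subr_eq0 -normr_eq0; apply/negPn/negP => n0.
have [e ne] : exists e : R, `|s - s'| = e%:C%C.
  by exists (complex.Re `|s - s'|); rewrite RRe_real // normr_real.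
have e0 : 0 < e by rewrite -ltcR -ne lt_def n0 normr_ge0.
have e20 : 0 < e / 2 by rewrite divr_gt0.
have [F FP] := fs _ e20; have [G GP] := fs' _ e20.
have uU : uniq (undup (F ++ G)) by exact: undup_uniq.
have sF : {subset F <= undup (F ++ G)} by move=> x; rewrite mem_undup mem_cat => ->.
have sG : {subset G <= undup (F ++ G)}.
  by move=> x; rewrite mem_undup mem_cat => ->; rewrite orbT.
move: (FP _ uU sF) (GP _ uU sG); set S := \sum_(x <- _) _; rewrite distrC => lt1 lt2.
have := le_lt_trans (ler_normD (s - S) (S - s')) (ltrD lt1 lt2).
by rewrite subrKA ne -rmorphD /= -splitr ltxx.
Qed.

Lemma csum_finite (T : eqType) (f : T -> C) (F : seq T) :
  uniq F -> (forall x, x \notin F -> f x = 0) -> csum f = \sum_(x <- F) f x.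
Proof.
move=> uF f0; rewrite /csum; case: xgetP => [s _ /= sP|/(_ (\sum_(x <- F) f x))[]].
  by apply: has_sum_unique sP _; exact: has_sum_finite.
exact: has_sum_finite.
Qed.

(** Moves a sum to the index type [nat] required by [separable]; numbers that code no index
    contribute zero. *)
Lemma has_sum_pickle (I : countType) (f : I -> C) (s : C) :
  has_sum f s -> has_sum (fun n => oapp f 0 (pickle_inv n)) s.
Proof.
move=> fs eps /fs [F FP]; exists (map pickle F) => G uG FG.
rewrite -big_pmap; apply: FP.
  exact: (pmap_uniq (@pickle_invK I) uG).
move=> x xF; rewrite mem_pmap; apply/mapP; exists (pickle x).
  by apply: FG; exact: map_f.
by rewrite pickleK_inv.
Qed.

(** Normalises a vector, its squared norm passing into the weight of the mixture. A zero vector is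
    replaced by the basis vector at [t0]. *)
Lemma unit_vector (T : eqType) (s : seq T) (t0 : T) (f : T -> C) :
  uniq s -> t0 \in s -> (forall x, x \notin s -> f x = 0) ->
  exists g : T -> C, [/\ forall x, x \notin s -> g x = 0,
    \sum_(x <- s) `|g x| ^+ 2 = 1 &
    forall x y, f x * (f y)^* = (\sum_(x <- s) `|f x| ^+ 2) * (g x * (g y)^*)].
Proof.
move=> us t0s f0; set N := \sum_(x <- s) _.
have N0 : 0 <= N by apply: sumr_ge0 => x _; rewrite exprn_ge0.
have [NZ|NZ] := eqVneq N 0.
  have fZ x : f x = 0.
    have [xs|/f0//] := boolP (x \in s); apply/eqP; rewrite -normr_eq0 -sqrf_eq0.
    move/eqP: NZ; rewrite /N psumr_eq0 => [/allP/(_ _ xs)//|y _].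
    by rewrite exprn_ge0.
  exists (fun x => (x == t0)%:R); split => [x xs||x y].
  - by case: eqP xs => // ->; rewrite t0s.
  - rewrite (bigD1_seq t0) //= eqxx normr1 expr1n big1 ?addr0 // => x /negbTE ->.
    by rewrite normr0 expr0n.
  - by rewrite NZ fZ !mul0r.
exists (fun x => f x / sqrtC N); split => [x /f0 ->||x y].
- by rewrite mul0r.
- under eq_bigr => x _ do rewrite normf_div expr_div_n.
  rewrite -mulr_suml ger0_norm ?sqrtC_ge0 // sqrtCK divff //.
- have -> : (f y / sqrtC N)^* = (f y)^* / sqrtC N.
    rewrite rmorphM fmorphV; congr (_ / _).
    by rewrite /= geC0_conj ?sqrtC_ge0.
  by rewrite mulrACA -invfM -expr2 sqrtCK mulrCA divff ?mulr1.
Qed.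

Lemma separable_countable (d : nat) (T : eqType) (I : countType) (i0 : 'I_d) (t0 : I -> T)
    (h0 : I) (c : I -> C) (a : I -> 'I_d -> C) (b : I -> T -> C) (s : I -> seq T)
    (rho : kernel R ('I_d * T)) :
  (forall h, 0 <= c h) -> (forall h, uniq (s h)) -> (forall h, t0 h \in s h) ->
  (forall h t, t \notin s h -> b h t = 0) ->
  has_sum (fun h => c h * ((\sum_i `|a h i| ^+ 2) * \sum_(t <- s h) `|b h t| ^+ 2)) 1 ->
  (forall x y, has_sum (fun h => c h *
     ((a h x.1 * (a h y.1)^*) * (b h x.2 * (b h y.2)^*))) (rho x y)) ->
  separable rho.
Proof.
move=> c0 us t0s bs sum1 sumrho.
have [g gP] := choice (fun h => @unit_vector _ (index_enum 'I_d) i0 (a h)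
  (index_enum_uniq _) (mem_index_enum _) (fun x => contraNeq (fun _ => mem_index_enum x))).
have [g' g'P] := choice (fun h => @unit_vector _ (s h) (t0 h) (b h) (us h) (t0s h) (bs h)).
set A := fun h : I => \sum_i `|a h i| ^+ 2 in sum1 *.
set B := fun h : I => \sum_(t <- s h) `|b h t| ^+ 2 in sum1 *.
have w0 h : 0 <= c h * (A h * B h).
  by rewrite !mulr_ge0 // sumr_ge0 // => x _; rewrite exprn_ge0.
pose p n := complex.Re (oapp (fun h => c h * (A h * B h)) 0 (pickle_inv n)).
have pE n : (p n)%:C%C = oapp (fun h => c h * (A h * B h)) 0 (pickle_inv n).
  by rewrite RRe_real // ger0_real //; case: pickle_inv => [h|] /=.
(* At numbers that code no index the weight is zero, and [h0] supplies unit vectors. *)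
exists p, (fun n => g (odflt h0 (pickle_inv n))), (fun n => g' (odflt h0 (pickle_inv n))).
split.
- by move=> n; rewrite -lecR pE; case: pickle_inv => [h|] /=.
- rewrite (_ : (fun n => _) = fun n => oapp (fun h => c h * (A h * B h)) 0 (pickle_inv n)).
    exact: has_sum_pickle.
  by apply/funext => n; exact: pE.
- by move=> n; have [] := gP (odflt h0 (pickle_inv n)).
- move=> n; have [g0 <- _] := g'P (odflt h0 (pickle_inv n)).
  by apply: has_sum_finite => // x /g0 ->; rewrite normr0 expr0n.
- move=> x y; have := has_sum_pickle (sumrho x y); congr has_sum; apply/funext => n.
  rewrite pE; case: pickle_inv => [h|] /=; last by rewrite !mul0r.
  have [_ _ ->] := gP h; have [_ _ ->] := g'P h.
  by rewrite (mulrACA (A h)) -!mulrA.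
Qed.

(** * Sums over a disjoint union of finite blocks *)

Section Blocks.
Variable J : nat -> finType.

Definition blocks n : seq {k : nat & J k} :=
  [seq existT J k f | k <- iota 0 n, f <- enum (J k)].

Lemma blocks_uniq n : uniq (blocks n).
Proof.
apply: allpairs_uniq_dep => [|k _|[k f] [k' f'] _ _ //]; first exact: iota_uniq.
exact: enum_uniq.
Qed.

Lemma mem_blocks n x : (x \in blocks n) = (tag x < n)%N.
Proof.
apply/allpairsPdep/idP => [[k [f [kn _ ->]]]|]; first by move: kn; rewrite mem_iota.
case: x => k f /= kn.
by exists k, f; rewrite mem_iota mem_enum.
Qed.

Lemma sum_blocks n (f : {k : nat & J k} -> C) :
  \sum_(x <- blocks n) f x = \sum_(k < n) \sum_(g : J k) f (existT J k g).
Proof.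
rewrite big_allpairs_dep -(big_mkord xpredT (fun k => \sum_(g : J k) f (existT J k g))).
rewrite /index_iota subn0; apply: eq_bigr => k _.
by rewrite big_enum.
Qed.

Lemma has_sum_block k (f : {k : nat & J k} -> C) :
  (forall x, tag x != k -> f x = 0) -> has_sum f (\sum_(g : J k) f (existT J k g)).
Proof.
move=> f0.
have -> : \sum_(g : J k) f (existT J k g) = \sum_(x <- map (existT J k) (enum (J k))) f x.
  by rewrite big_map big_enum.
apply: has_sum_finite.
  rewrite map_inj_in_uniq ?enum_uniq // => g g' _ _; exact: eq_from_Tagged.
move=> [k' g] xk; apply: f0 => /=; apply: contra xk => /eqP E; subst k'.
by rewrite map_f // mem_enum.
Qed.

(** By nonnegativity, a finite sum containing the first [n] blocks lies between their partial sum
    and that of some larger initial family of blocks, which is at most 1. *)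
Lemma has_sum_blocks_ge0 (f : {k : nat & J k} -> C) (t : nat -> R) :
  (forall x, 0 <= f x) -> (forall k, \sum_(g : J k) f (existT J k g) = (t k)%:C%C) ->
  (forall n, \sum_(k < n) t k <= 1) ->
  (forall eps, 0 < eps -> exists n, 1 - eps < \sum_(k < n) t k) ->
  has_sum f 1.
Proof.
move=> f0 ft t1 tlim eps /tlim [n nP]; exists (blocks n) => F uF nF.
have bE m : \sum_(x <- blocks m) f x = (\sum_(k < m) t k)%:C%C.
  by rewrite sum_blocks rmorph_sum; apply: eq_bigr => k _; rewrite ft.
have Fle1 : \sum_(x <- F) f x <= 1.
  pose m := \max_(x <- F) (tag x).+1.
  apply: (@le_trans _ _ (\sum_(x <- blocks m) f x)); last by rewrite bE lecR.
  rewrite (big_uniq_subset f uF (blocks_uniq m)) ?lerDl ?sumr_ge0 // => x xF.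
  by rewrite mem_blocks /m; exact: (@leq_bigmax_seq _ F xpredT (fun x => (tag x).+1) x xF isT).
rewrite distrC ger0_norm ?subr_ge0 //.
apply: (@le_lt_trans _ _ (1 - \sum_(x <- blocks n) f x)).
  rewrite lerD2l lerN2 (big_uniq_subset f (blocks_uniq n) uF nF) lerDl.
  exact: sumr_ge0.
by rewrite bE -(rmorph1 (real_complex R)) -rmorphB ltcR ltrBlDr -ltrBlDl.
Qed.

End Blocks.

End HasSum.

(** * The negative binomial series *)

Section NegativeBinomial.
Variables (R : realType) (z : R).
Hypotheses (z0 : 0 <= z) (z1 : z < 1).

Let T d n : R := \sum_(k < n) 'C(k + d, d)%:R * z ^+ k.

Let T0 n : (1 - z) * T 0 n = 1 - z ^+ n.
Proof.
rewrite /T; under eq_bigr => k _ do rewrite bin0 mul1r.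
by rewrite -{2}(expr1n _ n) subrXX; congr (_ * _); apply: eq_bigr => k _; rewrite expr1n mul1r.
Qed.

(** Multiplication by [1 - z] replaces the coefficients by their differences, given by Pascal's
    rule, up to one boundary term. *)
Let TS d n : (1 - z) * T d.+1 n = T d n - 'C(n + d, d.+1)%:R * z ^+ n.
Proof.
rewrite /T; elim: n => [|n IHn].
  by rewrite !big_ord0 bin_small // !mul0r mulr0 subrr.
rewrite !big_ord_recr /= mulrDr IHn addSn addnS !binS exprS natrD; ring.
Qed.

Lemma negbin_partial_le1 d n :
  \sum_(k < n) (1 - z) ^+ d.+1 * ('C(k + d, d)%:R * z ^+ k) <= 1.
Proof.
rewrite -mulr_sumr -/(T d n); elim: d => [|d IHd].
  by rewrite expr1 T0 gerBl exprn_ge0.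
rewrite exprSr -mulrA (le_trans _ IHd) // ler_wpM2l ?exprn_ge0 ?subr_ge0 ?(ltW z1) //.
by rewrite TS gerBl mulr_ge0 ?exprn_ge0.
Qed.

Local Open Scope classical_set_scope.

Let term_cvg0 d : ('C(n + d, d)%:R * z ^+ n : R) @[n --> \oo] --> (0 : R).
Proof.
(* The partial sums are nondecreasing and bounded, so the series converges and its terms tend to
   zero. *)
apply: cvg_series_cvg_0; apply: nondecreasing_is_cvgn.
  apply/nondecreasing_seqP => n; rewrite /series /= big_nat_recr //= lerDl.
  by rewrite mulr_ge0 ?exprn_ge0.
exists ((1 - z) ^- d.+1) => _ [n _ <-]; rewrite /series /= big_mkord.
have z1' : 0 < (1 - z) ^+ d.+1 by rewrite exprn_gt0 ?subr_gt0.
by rewrite -[leRHS]mulr1 -ler_pdivrMl ?invr_gt0 // invrK mulr_sumr negbin_partial_le1.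
Qed.

Let T_cvg1 d : (1 - z) ^+ d.+1 * T d n @[n --> \oo] --> (1 : R).
Proof.
elim: d => [|d IHd].
  under eq_fun do rewrite expr1 T0.
  rewrite -[X in nbhs X](subr0 (1 : R)); apply: cvgB; first exact: cvg_cst.
  by apply: cvg_expr; rewrite ger0_norm.
under eq_fun do rewrite exprSr -mulrA TS mulrBr.
rewrite -[X in nbhs X](subr0 (1 : R)); apply: cvgB; first exact: IHd.
rewrite -(mulr0 ((1 - z) ^+ d.+1)); apply: cvgMl_tmp.
(* The boundary term is dominated by the general term of the series of index [d.+1]. *)
apply: (squeeze_cvgr _ (cvg_cst 0) (term_cvg0 d.+1)); apply: nearW => n.
rewrite mulr_ge0 ?exprn_ge0 //= ler_wpM2r ?exprn_ge0 // ler_nat addnS binS.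
exact: leq_addr.
Qed.

Lemma negbin_partial_lim d eps : 0 < eps ->
  exists n, 1 - eps < \sum_(k < n) (1 - z) ^+ d.+1 * ('C(k + d, d)%:R * z ^+ k).
Proof.
move=> e0; have /cvgrPdist_lt/(_ _ e0)[N _ /(_ N (leqnn N))] := T_cvg1 d.
rewrite /= ltr_distlC => /andP[ltN _]; exists N.
by rewrite -mulr_sumr.
Qed.

End NegativeBinomial.

(** * Fock labels of fixed total excitation *)

Section Shell.
Variable d : nat.

(** No occupation number exceeds the total [k], so the labels come from tuples over ['I_k.+1], for
    which the stars-and-bars count applies. *)
Definition shell k : seq (fock d.+1) :=
  [seq [ffun j => val (tnth t j)] | t <- enum [set t : d.+1.-tuple 'I_k.+1 | (\sum_(i <- t) i)%N == k]].

Lemma shell_uniq k : uniq (shell k).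
Proof.
rewrite map_inj_uniq ?enum_uniq // => t t' /ffunP tt; apply: eq_from_tnth => j.
by apply: val_inj; have := tt j; rewrite !ffunE.
Qed.

Lemma size_shell k : size (shell k) = 'C(d + k, d).
Proof. by rewrite size_map -cardE card_ord_partitions. Qed.

Lemma mem_shell k e : (e \in shell k) = (tot e == k).
Proof.
apply/mapP/eqP => [[t]|ek].
  rewrite mem_enum inE big_tuple => /eqP tk ->.
  by rewrite -[RHS]tk; apply: eq_bigr => j _; rewrite ffunE.
have le_ek j : (e j < k.+1)%N by rewrite ltnS -ek /tot (bigD1 j) //= leq_addr.
exists [tuple Ordinal (le_ek j) | j < d.+1].
  rewrite mem_enum inE big_tuple; apply/eqP; rewrite -[RHS]ek.
  by apply: eq_bigr => j _; rewrite tnth_mktuple.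
by apply/ffunP => j; rewrite ffunE tnth_mktuple.
Qed.

(** The inner sum is constantly [d+1+k] on the shell, and [(d+1+k) C(d+k, d) = (d+1) C(d+1+k, d+1)].
    This is the trace of block [k] of the Choi state, up to its scalar. *)
Lemma sum_shell (R : realFieldType) k :
  \sum_(e <- shell k) \sum_i (1 + (e i)%:R) = (d.+1 * 'C(d.+1 + k, d.+1))%:R :> R.
Proof.
transitivity (\sum_(e <- shell k) (d.+1 + k)%:R : R).
  rewrite !big_seq; apply: eq_bigr => e; rewrite mem_shell => /eqP ek.
  by rewrite big_split /= sumr_const card_ord -natr_sum natrD -ek.
rewrite big_const_seq count_predT size_shell iter_addr_0 -mulrnA.
by have /= <- := mul_bin_diag (d.+1 + k) d.
Qed.

End Shell.

Lemma raiseE d (e : fock d) i j : raise e i j = (e j + (j == i))%N.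
Proof. by rewrite ffunE. Qed.

Lemma tot_raise d (e : fock d) i : tot (raise e i) = (tot e).+1.
Proof.
rewrite /tot; under eq_bigr => j _ do rewrite raiseE.
by rewrite big_split /= -big_mkcond /= sum1_card card1 addn1.
Qed.

(** * Entries of the Choi state, and their expression as Gaussian moments *)

Section Hyperbolic.
Variables (R : realType) (r : R).

Lemma cosh_gt0 : 0 < cosh r.
Proof. by rewrite /cosh divr_gt0 // addr_gt0 ?expR_gt0. Qed.

Lemma sub1_sqr_tanh : 1 - tanh r ^+ 2 = cosh r ^- 2.
Proof.
have c0 := lt0r_neq0 cosh_gt0.
have E : cosh r ^+ 2 - sinh r ^+ 2 = 1.
  have : expR r * expR (- r) = 1 by rewrite -expRD subrr expR0.
  by rewrite /cosh /sinh => e; rewrite -[RHS]e; field.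
by rewrite /tanh expr_div_n -{1}(divff (expf_neq0 2 c0)) -mulrBl E mul1r.
Qed.

End Hyperbolic.

(** One node is chosen independently for each mode, so the sum factors over the modes. *)
Lemma sum_prod_moments (C : numClosedFieldType) d n (Q : finType) (u phi : Q -> C) :
  (forall a b, (a <= n)%N -> (b <= n)%N ->
    \sum_q u q * (phi q ^+ a * (phi q)^* ^+ b) = (a == b)%:R * a`!%:R) ->
  forall e e' : fock d, (forall l, e l <= n)%N -> (forall l, e' l <= n)%N ->
  \sum_(f : {ffun 'I_d -> Q}) (\prod_l u (f l)) *
    ((\prod_l phi (f l) ^+ e l) * (\prod_l phi (f l) ^+ e' l)^*) =
  (e == e')%:R * \prod_l (e l)`!%:R.
Proof.
move=> mom e e' en e'n.
transitivity (\prod_l \sum_q u q * (phi q ^+ e l * (phi q)^* ^+ e' l)).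
  rewrite bigA_distr_bigA /=; apply: eq_bigr => f _.
  by rewrite rmorph_prod -!big_split /=; apply: eq_bigr => l _; rewrite rmorphXn.
under eq_bigr => l _ do rewrite mom //.
rewrite big_split /=; congr (_ * _); have [->|ne] := eqVneq e e'.
  by rewrite big1 // => l _; rewrite eqxx.
have [l nl] : exists l, e l != e' l.
  apply/existsP; apply: contraNT ne; rewrite negb_exists => /forallP E.
  by apply/eqP/ffunP => l; apply/eqP; rewrite -[_ == _]negbK.
by rewrite (bigD1 l) //= (negbTE nl) mul0r.
Qed.

Section FactorialWeight.
Variables (R : realType) (d : nat).

(** The Bargmann norm of the monomial with exponents [e]; dividing by it turns monomials into Fock
    amplitudes. *)
Definition sqrt_fact (e : fock d) : R := \prod_l Num.sqrt (e l)`!%:R.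

Lemma sqrt_fact_gt0 e : 0 < sqrt_fact e.
Proof. by apply: prodr_gt0 => l _; rewrite sqrtr_gt0 ltr0n fact_gt0. Qed.

Lemma sqr_sqrt_fact e : sqrt_fact e ^+ 2 = \prod_l (e l)`!%:R.
Proof. by rewrite -prodrXl; apply: eq_bigr => l _; rewrite sqr_sqrtr. Qed.

Lemma sqrt_fact_raise e i :
  sqrt_fact (raise e i) = Num.sqrt (1 + (e i)%:R) * sqrt_fact e.
Proof.
rewrite /sqrt_fact (bigD1 i) //= [in RHS](bigD1 i) //= mulrA raiseE eqxx addn1.
rewrite factS natrM sqrtrM // -natr1 addrC; congr (_ * _).
by apply: eq_bigr => l /negbTE li; rewrite raiseE li addn0.
Qed.

End FactorialWeight.

Section Unruh.
Variables (R : realType) (d : nat) (r : R).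
Notation C := R[i]%C.

(** Given [i] and the environment label [e], the only output label is [raise e i], so the partial
    trace has at most one nonzero term. When it is present, [e] and [e'] have equal totals and the
    powers of [tanh r] combine. *)
Lemma choi_unruh (i j : 'I_d) (e e' : fock d) :
  choi (complementary (unruhV d r)) (i, e) (j, e') =
  (raise e i == raise e' j)%:R *
  (d%:R^-1 * (tanh r ^+ 2) ^+ tot e / (cosh r ^+ 2) ^+ d.+1 *
   (Num.sqrt (1 + (e i)%:R) * Num.sqrt (1 + (e' j)%:R)))%:C%C.
Proof.
rewrite /choi /complementary /ptrace_1 /=.
pose g b : C := unruhV d r i (b, e) * (unruhV d r j (b, e'))^*.
have -> : (fun b => conj_by (unruhV d r) (delta_mx i j) (b, e) (b, e')) = g.
  apply/funext => b; rewrite /conj_by (bigD1 i) //= (bigD1 j) //= big1 => [|l lj].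
    rewrite big1 => [|l li]; first by rewrite mxE !eqxx mulr1 !addr0.
    by rewrite big1 // => l' _; rewrite mxE (negbTE li) mulr0 mul0r.
  by rewrite mxE eqxx (negbTE lj) mulr0 mul0r.
rewrite (@csum_finite _ _ g [:: raise e i]) // => [|b]; last first.
  by rewrite inE /g /unruhV => /negbTE ->; rewrite mul0r.
rewrite big_seq1 /g /unruhV eqxx; case: eqP => [E|_]; last first.
  by rewrite conjC0 !mulr0 mul0r.
have tE : tot e' = tot e by apply: succn_inj; rewrite -(tot_raise e i) E tot_raise.
rewrite mul1r tE.
have -> (x : R) : (x%:C%C)^* = x%:C%C by apply: conjc_real.
rewrite -rmorphM -(rmorph_nat (real_complex R)) -fmorphV -rmorphM; congr (_%:C)%C.
have : cosh r ^+ d.+1 != 0 by rewrite expf_neq0 // lt0r_neq0 // cosh_gt0.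
rewrite !(exprAC _ 2); move: (cosh r ^+ d.+1) (tanh r ^+ _) => y t y0.
rewrite !expr2 invfM; ring.
Qed.

End Unruh.

(** Multiplying the monomial of [e] by the variable of mode [i] gives the monomial of [raise e i],
    whose exponents are at most [k.+1]; orthogonality of monomials then yields the Kronecker
    delta. *)
Lemma sum_unruh_amplitudes (R : realType) d k (Q : finType) (u phi : Q -> R[i]%C) :
  (forall a b, (a <= k.+1)%N -> (b <= k.+1)%N ->
    \sum_q u q * (phi q ^+ a * (phi q)^* ^+ b) = (a == b)%:R * a`!%:R) ->
  forall (i j : 'I_d) (e e' : fock d), tot e = k -> tot e' = k ->
  \sum_(f : {ffun 'I_d -> Q}) (\prod_l u (f l)) *
    (phi (f i) * (phi (f j))^* *
     ((\prod_l phi (f l) ^+ e l) / (sqrt_fact R e)%:C%C *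
      ((\prod_l phi (f l) ^+ e' l) / (sqrt_fact R e')%:C%C)^*)) =
  (raise e i == raise e' j)%:R *
  (Num.sqrt (1 + (e i)%:R) * Num.sqrt (1 + (e' j)%:R))%:C%C.
Proof.
move=> mom i j e e' ek e'k.
have raiseM (f : {ffun 'I_d -> Q}) l (g : fock d) :
    phi (f l) * (\prod_m phi (f m) ^+ g m) = \prod_m phi (f m) ^+ raise g l m.
  rewrite (bigD1 l) //= [in RHS](bigD1 l) //= mulrA -exprS raiseE eqxx addn1.
  by congr (_ * _); apply: eq_bigr => m /negbTE ml; rewrite raiseE ml addn0.
have le_raise (g : fock d) l m : tot g = k -> (raise g l m <= k.+1)%N.
  by move=> <-; rewrite -(tot_raise g l) /tot (bigD1 m) //= leq_addr.
pose s (g : fock d) : R[i]%C := (sqrt_fact R g)%:C%C.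
have sN g : s g != 0 by rewrite (inj_eq (@complexI _) _ 0) lt0r_neq0 // sqrt_fact_gt0.
have sc g : ((s g)^-1)^* = (s g)^-1.
  by rewrite fmorphV; congr _^-1; exact: conjc_real.
transitivity ((s e * s e')^-1 * \sum_(f : {ffun 'I_d -> Q}) (\prod_l u (f l)) *
    ((\prod_m phi (f m) ^+ raise e i m) * (\prod_m phi (f m) ^+ raise e' j m)^*)).
  rewrite mulr_sumr; apply: eq_bigr => f _.
  rewrite -!raiseM -/(s e) -/(s e').
  by rewrite ![(_ * _)^* as X in _ * X]rmorphM /= sc invfM; ring.
rewrite (sum_prod_moments mom) => [|l|l]; last 2 first.
- exact: le_raise.
- exact: le_raise.
rewrite mulrCA; case: eqP => [E|_]; last by rewrite !mul0r.
rewrite !mul1r.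
(* As [raise e i = raise e' j], the product of factorials is the product of their Bargmann norms,
   each of which splits off one square root. *)
have -> : \prod_l (raise e i l)`!%:R =
    (Num.sqrt (1 + (e i)%:R) * Num.sqrt (1 + (e' j)%:R))%:C%C * (s e * s e').
  under eq_bigr => l _ do rewrite -(rmorph_nat (real_complex R)).
  rewrite -rmorph_prod -sqr_sqrt_fact expr2 {2}E !sqrt_fact_raise /s -!rmorphM.
  by congr (_%:C)%C; rewrite mulrACA.
by rewrite mulrC mulfK // mulf_neq0.
Qed.

(** * The separable decomposition of the Choi state *)

Theorem theorem2 (R : realType) (d : nat) (r : R) :
  (2 <= d)%N ->
  hadamard (unruhV d r).
Proof.
case: d => // d _.
set z := tanh r ^+ 2.
have z0 : 0 <= z by exact: sqr_ge0.
have cz : 1 - z = (cosh r ^+ 2)^-1 by exact: sub1_sqr_tanh.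
have z1 : z < 1 by rewrite -subr_gt0 cz invr_gt0 exprn_gt0 // cosh_gt0.
(* Exponents in block [k] reach [k.+1], one from the qudit and [k] from the environment; quadrature
   of that order uses [k.+2] moduli and [k.+2] phases. *)
pose node k := ('I_k.+2 * 'I_k.+2)%type.
pose u k := sval (cid (gaussian_quadrature R[i]%C k.+1)).
pose phi k := sval (cid (svalP (cid (gaussian_quadrature R[i]%C k.+1)))).
have quad k : (forall q, 0 <= u k q) /\ forall a b, (a <= k.+1)%N -> (b <= k.+1)%N ->
    \sum_q u k q * (phi k q ^+ a * (phi k q)^* ^+ b) = (a == b)%:R * a`!%:R.
  exact: (svalP (cid (svalP (cid (gaussian_quadrature R[i]%C k.+1))))).
(* A product state of the mixture is indexed by a block [k] and a choice of one
   quadrature node per mode. *)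
pose J k : finType := {ffun 'I_d.+1 -> node k}.
pose I : countType := {k : nat & J k}.
(* The common scalar of the Choi entries in block [k]; there are now [d.+1] modes, hence the
   exponent [d.+2]. *)
pose K k : R := d.+1%:R^-1 * z ^+ k / (cosh r ^+ 2) ^+ d.+2.
have K0 k : 0 <= K k.
  rewrite /K divr_ge0 // ?(exprn_ge0 _ (sqr_ge0 _)) // mulr_ge0 ?invr_ge0 ?ler0n //.
  exact: exprn_ge0.
pose a (h : I) i := phi (tag h) (tagged h i).
(* The component with [tag h] excitations of an unnormalised coherent state, which makes its support
   finite. *)
pose b (h : I) (e : fock d.+1) := (tot e == tag h)%:R *
  ((\prod_l phi (tag h) (tagged h l) ^+ e l) / (sqrt_fact R e)%:C%C).
pose c (h : I) := (K (tag h))%:C%C * \prod_l u (tag h) (tagged h l).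
have c0 h : 0 <= c h.
  by rewrite mulr_ge0 ?lecR // prodr_ge0 // => l _; have [] := quad (tag h).
have bZ h e : tot e != tag h -> b h e = 0.
  by rewrite /b => /negbTE ->; rewrite mul0r.
have block k x y : tot x.2 = k -> tot y.2 = k ->
    \sum_(f : J k) c (existT J k f) * (a (existT J k f) x.1 * (a (existT J k f) y.1)^* *
       (b (existT J k f) x.2 * (b (existT J k f) y.2)^*)) =
    choi (complementary (unruhV d.+1 r)) x y.
  case: x y => [i e] [j e'] /= ek e'k.
  rewrite choi_unruh [X in _ * X]rmorphM /= mulrCA ek -/z -/(K k).
  rewrite -(sum_unruh_amplitudes (quad k).2) // mulr_sumr; apply: eq_bigr => f _.
  by rewrite /c /a /b /= ek e'k eqxx !mul1r -!mulrA.
have h0 : I by exact: (existT J 0%N [ffun=> (ord0, ord0)]).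
(* The chosen point of each shell puts all [tag h] excitations in mode 0. *)
apply: (@separable_countable _ _ _ I ord0
  (fun h => [ffun l => if l == ord0 then tag h else 0%N]) h0 c a b
  (fun h => shell d (tag h))) => [//|h|h|h e|| x y].
- exact: shell_uniq.
- rewrite mem_shell /tot (bigD1 ord0) //= ffunE eqxx big1 ?addn0 // => l /negbTE l0.
  by rewrite ffunE l0.
- by rewrite mem_shell; exact: bZ.
(* The mass of block [k] is the sum of its diagonal Choi entries, a term of the normalised negative
   binomial series. *)
- apply: (@has_sum_blocks_ge0 _ J _ (fun k => (1 - z) ^+ d.+2 * ('C(k + d.+1, d.+1)%:R * z ^+ k))).
  + by move=> h; rewrite mulr_ge0 // mulr_ge0 // sumr_ge0 // => *; exact: exprn_ge0.
  + move=> k.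
    transitivity (\sum_(i < d.+1) \sum_(e <- shell d k) (K k * (1 + (e i)%:R))%:C%C).
      under eq_bigr => f _.
        rewrite big_distrlr /= mulr_sumr.
        under eq_bigr => i _ do rewrite mulr_sumr.
        over.
      rewrite exchange_big; apply: eq_bigr => i _; rewrite exchange_big !big_seq.
      apply: eq_bigr => e; rewrite mem_shell => /eqP ek.
      under eq_bigr => f _ do rewrite !normCK.
      rewrite (block k (i, e) (i, e)) // choi_unruh eqxx mul1r ek -/z -/(K k).
      by rewrite -expr2 sqr_sqrtr // addr_ge0.
    rewrite exchange_big /=; under eq_bigr => e _ do rewrite -rmorph_sum -mulr_sumr.
    rewrite -rmorph_sum -mulr_sumr sum_shell natrM; congr (_%:C)%C; rewrite /K (addnC k) cz exprVn.
    have dN : d.+1%:R != 0 :> R by rewrite pnatr_eq0.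
    move: d.+1%:R dN 'C(_, _)%:R (z ^+ k) (_ ^- d.+2) => D D0 E A B; by field.
  + exact: negbin_partial_le1.
  + exact: negbin_partial_lim.
- have [xy|xy] := eqVneq (tot x.2) (tot y.2).
    rewrite -(block (tot x.2)) //; apply: has_sum_block => h hx.
    by rewrite (bZ h x.2) ?mul0r ?mulr0 // eq_sym.
  (* Between different totals the Choi entry vanishes, since raising adds one to each total; every
     term of the mixture vanishes too, its environment vector living on a single shell. *)
  rewrite (_ : choi _ x y = 0); last first.
    case: x y xy => [i e] [j e'] /= ne; rewrite choi_unruh; case: eqP => [E|_]; last by rewrite mul0r.
    by case/eqP: ne; apply: succn_inj; rewrite -(tot_raise e i) E tot_raise.
  rewrite -[0](big_nil 0 +%R xpredT (fun _ : I => 0)).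
  rewrite (_ : (fun h => _) = fun=> 0); first exact: has_sum_finite.
  apply/funext => h; apply/eqP; rewrite mulf_eq0; apply/orP; right; apply/eqP.
  have [xh|/bZ ->] := eqVneq (tot x.2) (tag h); last by rewrite mul0r mulr0.
  by rewrite (bZ h y.2) ?rmorph0 ?mulr0 // -xh eq_sym.
Qed.
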